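(* For every integer $d\ge1$ there is a constant $c=c(d)$ such that the following holds. Let $G$ be a weakly observable directed graph with $N$ vertices in which every vertex has in-degree at most $d$. Then for every sufficiently large $T$ (how large may depend on $G$) there is an algorithm for bandit with feedback graph $G$ and horizon $T$ such that for every loss sequence $\ell^{(1)},\dots,\ell^{(T)}$ its regret satisfies $$R(T)\le c\,N^{\frac13}\cdot T^{\frac23}.$$
   Context: **Problem (bandit with graph feedback).** $G=(V,E)$ is a finite directed graph, possibly with self-loops; vertices are called arms. $N_{\mathrm{in}}(v)=\{u:(u,v)\in E\}$, $N_{\mathrm{out}}(v)=\{u:(v,u)\in E\}$; the in-degree of $v$ is $|N_{\mathrm{in}}(v)|$. The player knows $G$ and the horizon $T$. In each round $t=1,\dots,T$ the player's (randomized) algorithm computes from past observations a distribution on $V$ and samples an arm $A_t$ from it; there is a loss vector $\ell^{(t)}:V\to[0,1]$; the player pays $\ell^{(t)}(A_t)$ and observes exactly the values $\ell^{(t)}(v)$ for $v\in N_{\mathrm{out}}(A_t)$. For a fixed loss sequence, the regret with respect to arm $a$ is $R_a(T)=\mathbf E[\sum_{t=1}^T\ell^{(t)}(A_t)]-\sum_{t=1}^T\ell^{(t)}(a)$, and $R(T)=\max_aR_a(T)$. **Observability.** A vertex $v$ is non-observable if $N_{\mathrm{in}}(v)=\emptyset$; it is strongly observable if it has a self-loop or $N_{\mathrm{in}}(v)=V\setminus\{v\}$. A graph is non-observable if it has a non-observable vertex, strongly observable if all its vertices are strongly observable, and weakly observable if it is neither non-observable nor strongly observable. *)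

(* Defs.v *)
From HB Require Import structures.
From mathcomp Require Import all_boot all_order all_algebra.
From mathcomp Require Import classical_sets reals exp.

Set Implicit Arguments.
Unset Strict Implicit.
Unset Printing Implicit Defensive.

Import Order.TTheory GRing.Theory Num.Theory.
Local Open Scope ring_scope.

(* A directed graph, possibly with self-loops, is a relation [E] on a finite
   type [V]: [E u v] means that (u, v) is an edge. *)

Definition in_nbrs (V : finType) (E : rel V) (v : V) : {set V} :=
  [set u | E u v].

Definition out_nbrs (V : finType) (E : rel V) (v : V) : {set V} :=
  [set u | E v u].

Definition in_degree (V : finType) (E : rel V) (v : V) : nat :=
  #|in_nbrs E v|.

Definition non_observable_vertex (V : finType) (E : rel V) (v : V) : bool :=
  in_nbrs E v == finset.set0.

Definition strongly_observable_vertex (V : finType) (E : rel V) (v : V) : bool :=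
  E v v || (in_nbrs E v == [set~ v]).

Definition non_observable (V : finType) (E : rel V) : bool :=
  [exists v, non_observable_vertex E v].

Definition strongly_observable (V : finType) (E : rel V) : bool :=
  [forall v, strongly_observable_vertex E v].

Definition weakly_observable (V : finType) (E : rel V) : bool :=
  ~~ non_observable E && ~~ strongly_observable E.

Record arm_dist (R : realType) (V : finType) := ArmDist {
  arm_prob :> V -> R;
  arm_prob_ge0 : forall a, 0 <= arm_prob a;
  arm_prob_sum1 : \sum_(a : V) arm_prob a = 1
}.

(* What the player sees on playing [a] under the loss vector [l]: the loss of
   each out-neighbour of [a], and nothing about the other arms. *)
Definition feedback (R : realType) (V : finType) (E : rel V)
    (l : V -> R) (a : V) : {ffun V -> option R} :=
  [ffun v => if v \in out_nbrs E a then Some (l v) else None].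

(* The rounds played so far, oldest first, each given by the arm played and
   the feedback received. *)
Definition history (R : realType) (V : finType) :=
  seq (V * {ffun V -> option R}).

(* The number of the current round is one plus the size of the history, so an
   algorithm need not be given it separately. *)
Definition algorithm (R : realType) (V : finType) :=
  history R V -> arm_dist R V.

(* Rounds are numbered from 0: ['I_T] stands for {1, ..., T}. *)
Definition loss_sequence (R : realType) (V : finType) (T : nat) :=
  'I_T -> V -> R.

Definition unit_losses (R : realType) (V : finType) (T : nat)
    (l : loss_sequence R V T) : Prop :=
  forall t v, 0 <= l t v <= 1.

Definition history_before (R : realType) (V : finType) (E : rel V) (T : nat)
    (l : loss_sequence R V T) (A : {ffun 'I_T -> V}) (t : 'I_T) : history R V :=
  [seq (A s, feedback E (l s) (A s)) | s : 'I_T <- enum 'I_T & (s < t)%N].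

(* The probability that the arms played are exactly A_1, ..., A_T, by the chain
   rule. *)
Definition play_prob (R : realType) (V : finType) (E : rel V) (T : nat)
    (alg : algorithm R V) (l : loss_sequence R V T)
    (A : {ffun 'I_T -> V}) : R :=
  \prod_(t < T) alg (history_before E l A t) (A t).

Definition expected_loss (R : realType) (V : finType) (E : rel V) (T : nat)
    (alg : algorithm R V) (l : loss_sequence R V T) : R :=
  \sum_(A : {ffun 'I_T -> V}) play_prob E alg l A * \sum_(t < T) l t (A t).

Definition regret_arm (R : realType) (V : finType) (E : rel V) (T : nat)
    (alg : algorithm R V) (l : loss_sequence R V T) (a : V) : R :=
  expected_loss E alg l - \sum_(t < T) l t a.

(* The supremum is a maximum, [V] being finite (and nonempty whenever some
   graph on it is weakly observable). It may be negative, so [0] would be a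
   wrong neutral element for an iterated maximum. *)
Definition regret (R : realType) (V : finType) (E : rel V) (T : nat)
    (alg : algorithm R V) (l : loss_sequence R V T) : R :=
  sup (range (regret_arm E alg l)).

(* Main.v *)
(* Run follow-the-regularized-leader with the 1/2-Tsallis regularizer. On the
   scaled cumulative loss estimates K its distribution is
   x_v = 1 / (K_v - mu)^2 with mu normalizing, and its optimal value is
   potential K. With probability 1 - gamma the arm is drawn from x; with
   probability gamma one draws v from x and plays an in-neighbour of v. Since v
   is then observed with probability at least gamma x_v, the second-order term
   of the potential is at most
     eta * sum_v x_v^(3/2) / (gamma x_v) <= eta sqrt N / gamma,
   as for bandits with N arms. This gives
     R(T) <= 2 sqrt N / eta + T (gamma + eta sqrt N / gamma),
   which is 4 N^(1/3) T^(2/3) for gamma = (N/T)^(1/3) and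
   eta = N^(1/6) / T^(2/3). Exploring according to x rather than uniformly is
   what saves the usual logarithmic factor. *)
Require Import Defs.
From HB Require Import structures.
From mathcomp Require Import all_boot all_order all_algebra.
From mathcomp Require Import classical_sets reals exp.
From mathcomp Require Import boolp topology normedtype.
From mathcomp Require Import ring lra.

Set Implicit Arguments.
Unset Strict Implicit.
Unset Printing Implicit Defensive.

Import Order.TTheory GRing.Theory Num.Theory.
Import numFieldNormedType.Exports.
Local Open Scope ring_scope.

(** * First- and second-order bounds on the reciprocal *)

Lemma tangent_inv (R : realFieldType) (y z : R) :
  0 < y -> 0 < z -> z^-1 >= y^-1 - (z - y) * y^-1 ^+ 2.
Proof.
move=> y0 z0; rewrite -subr_ge0.
have -> : z^-1 - (y^-1 - (z - y) * y^-1 ^+ 2) = z^-1 * (y^-1 * (z - y)) ^+ 2.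
  by field; rewrite !gt_eqF.
by rewrite mulr_ge0 ?sqr_ge0// invr_ge0 ltW.
Qed.

(** The geometric series of the reciprocal, cut after the quadratic term: the error has the sign of
    the next, cubic term. *)
Lemma inv_addr_le (R : realFieldType) (y k : R) :
  0 < y -> 0 <= k -> (y + k)^-1 <= y^-1 - y^-1 ^+ 2 * k + y^-1 ^+ 3 * k ^+ 2.
Proof.
move=> y0 k0; have yk : 0 < y + k by rewrite ltr_wpDr.
rewrite -subr_ge0.
have -> : y^-1 - y^-1 ^+ 2 * k + y^-1 ^+ 3 * k ^+ 2 - (y + k)^-1
    = (y^-1 * k) ^+ 3 * (y + k)^-1.
  by field; rewrite !gt_eqF.
by rewrite mulr_ge0 ?exprn_ge0 ?mulr_ge0 ?invr_ge0// ltW.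
Qed.

(** * The Tsallis distribution and its potential *)

Section Potential.
Context (R : realType) (V : finType).
Implicit Types (K k : V -> R) (v : V).

(* [K] holds cumulative losses already multiplied by the learning rate. *)
Definition is_shift K (mu : R) : Prop :=
  (forall v, mu < K v) /\ \sum_v ((K v - mu)^-1) ^+ 2 = 1.

(** Intermediate value theorem: at [K v1 - n] each of the [n] summands is at most [n^-1], while at
    [K v1 - 1] the summand of the minimizer [v1] alone is 1. *)
Lemma shift_exists v0 K : exists mu, is_shift K mu.
Proof.
pose v1 := [arg min_(v < v0) K v]%O.
have v1P v : K v1 <= K v by rewrite /v1; case: arg_minP => // i _; apply.
pose n : R := #|V|%:R.
have n1 : 1 <= n by rewrite /n ler1n; apply/card_gt0P; exists v0.
pose f (mu : R) := \sum_v ((K v - mu)^-1) ^+ 2.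
have ab : K v1 - n <= K v1 - 1 by lra.
have cf : {within `[K v1 - n, K v1 - 1], continuous f}%classic.
  apply: continuous_in_subspaceT => x; rewrite inE/= in_itv/= => /andP[_ xb].
  apply: (@cvg_big _ _ _ _ _ add_continuous) => // v _.
  have /cvgV/(_ _) h : (K v - mu @[mu --> x] --> K v - x)%classic.
    by apply: cvgB; [exact: cvg_cst | exact: cvg_id].
  have {}h := h (lt0r_neq0 _); under eq_fun do rewrite expr2; rewrite expr2.
  by apply: cvgM; apply: h; have := v1P v; lra.
have fa : f (K v1 - n) <= 1.
  apply: (@le_trans _ _ (\sum_(v : V) n^-1)).
    apply: ler_sum => v _; have v1v := v1P v.
    have ? : (K v - (K v1 - n))^-1 <= n^-1.
      by rewrite lef_pV2 ?posrE; lra.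
    have n0 : 0 < n^-1 by rewrite invr_gt0; lra.
    have n1' : n^-1 <= 1 by rewrite invf_le1; lra.
    have ? : 0 < (K v - (K v1 - n))^-1 by rewrite invr_gt0; lra.
    nra.
  by rewrite sumr_const -mulr_natl -/n divff//; lra.
have fb : 1 <= f (K v1 - 1).
  rewrite /f (bigD1 v1)//= [X in X^-1](_ : _ = 1); last by ring.
  by rewrite invr1 expr1n lerDl sumr_ge0// => v _; exact: sqr_ge0.
have /IVT : Num.min (f (K v1 - n)) (f (K v1 - 1)) <= 1
          <= Num.max (f (K v1 - n)) (f (K v1 - 1)).
  by rewrite ge_min fa le_max fb orbT.
move=> /(_ ab cf)[mu]; rewrite in_itv/= => /andP[_ muI] fmu.
by exists mu; split => // v; have := v1P v; lra.
Qed.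

Definition shift K : R := xget 0 [set mu | is_shift K mu]%classic.

Lemma shiftP v0 K : is_shift K (shift K).
Proof. by have [mu h] := shift_exists v0 K; exact: (xgetI 0 h). Qed.

Definition root K v : R := (K v - shift K)^-1.

(** The minimum of sum_v (K_v x_v - 2 sqrt x_v) over the simplex, simplified by K_v = mu + 1 / sqrt
    x_v at the minimizer. *)
Definition potential K : R := shift K - \sum_v root K v.

Lemma root_gt0 K v : 0 < root K v.
Proof. by rewrite invr_gt0 subr_gt0; have [+ _] := shiftP v K; exact. Qed.

Lemma sum_root_sqr v0 K : \sum_v root K v ^+ 2 = 1.
Proof. by have [] := shiftP v0 K. Qed.

(** Cauchy-Schwarz, through 2 r <= q r^2 + 1/q for each root r. *)
Lemma sum_root_le v0 K (q : R) : 0 < q -> q ^+ 2 = #|V|%:R ->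
  \sum_v root K v <= q.
Proof.
move=> q0 qE.
apply: (@le_trans _ _ (\sum_v (q * root K v ^+ 2 + q^-1) / 2)).
  apply: ler_sum => v _; rewrite -subr_ge0.
  have -> : (q * root K v ^+ 2 + q^-1) / 2 - root K v =
            (q * root K v - 1) ^+ 2 / (2 * q) by field; rewrite gt_eqF.
  by rewrite divr_ge0 ?sqr_ge0// mulr_ge0// ltW.
rewrite -mulr_suml big_split/= -mulr_sumr (sum_root_sqr v0) sumr_const.
rewrite -[q^-1 *+ _]mulr_natl -qE.
have -> : (q * 1 + q ^+ 2 / q) / 2 = q by field; rewrite gt_eqF.
by [].
Qed.

Lemma potential_le K v : potential K <= K v.
Proof.
have [+ _] := shiftP v K => /(_ v) h.
have : 0 <= \sum_w root K w by apply: sumr_ge0 => w _; exact/ltW/root_gt0.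
by rewrite /potential; lra.
Qed.

(* The left-hand side is the Lagrangian dual objective, concave in [mu]. *)
Lemma le_potential v0 K mu : (forall v, mu < K v) ->
  mu - \sum_v (K v - mu)^-1 <= potential K.
Proof.
move=> muK; have [sK s1] := shiftP v0 K.
have : \sum_v (root K v - (shift K - mu) * root K v ^+ 2)
    <= \sum_v (K v - mu)^-1.
  apply: ler_sum => v _.
  have := @tangent_inv _ (K v - shift K) (K v - mu).
  rewrite !subr_gt0 => /(_ (sK v) (muK v)).
  by rewrite -/(root K v); congr (_ - _ * _ <= _); ring.
rewrite sumrB -mulr_sumr (sum_root_sqr v0) /potential; lra.
Qed.

(** Since [k] is nonnegative, [shift K] stays feasible in the dual problem for the increased losses.
    Its dual value there bounds the new potential from below; each reciprocal is then expanded to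
    second order. *)
Lemma potential_addr v0 K k : (forall v, 0 <= k v) ->
  potential K + \sum_v root K v ^+ 2 * k v - \sum_v root K v ^+ 3 * k v ^+ 2
    <= potential (fun v => K v + k v).
Proof.
move=> k0; have [sK _] := shiftP v0 K.
have sKk v : shift K < K v + k v by rewrite (lt_le_trans (sK v))// lerDl.
apply: le_trans (le_potential v0 sKk).
rewrite /potential -!addrA lerD2l -!sumrN -!big_split/=; apply: ler_sum => v _.
have := @inv_addr_le _ (K v - shift K) (k v).
rewrite subr_gt0 => /(_ (sK v) (k0 v)).
rewrite -/(root K v) (_ : K v - shift K + k v = K v + k v - shift K); last by ring.
lra.
Qed.

Lemma potential0_ge v0 (q : R) : 0 < q -> q ^+ 2 = #|V|%:R ->
  - (2 * q) <= potential (fun=> 0).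
Proof.
move=> q0 qE; rewrite (le_trans _ (@le_potential v0 _ (- q) _))//; last first.
  by move=> v; rewrite oppr_lt0.
rewrite sub0r opprK sumr_const -[q^-1 *+ _]mulr_natl -qE.
have -> : q ^+ 2 / q = q by field; rewrite gt_eqF.
lra.
Qed.

End Potential.

(** * Expectations over the random play *)

Section Play.
Context (R : realType) (V : finType) (E : rel V).

Lemma history_before_lift (T : nat) (l : loss_sequence R V T.+1)
    (A : {ffun 'I_T.+1 -> V}) (t : 'I_T) :
  history_before E l A (lift ord0 t) =
  (A ord0, feedback E (l ord0) (A ord0)) ::
  history_before E (fun s => l (lift ord0 s)) [ffun s => A (lift ord0 s)] t.
Proof.
rewrite /history_before enum_ordSl/= filter_map -map_comp; congr cons.
by apply: eq_map => s /=; rewrite ffunE.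
Qed.

Definition ffun_cons (T : nat) (a : V) (A : {ffun 'I_T -> V}) :
    {ffun 'I_T.+1 -> V} :=
  [ffun t => oapp A a (unlift ord0 t)].

Lemma ffun_cons0 T a (A : {ffun 'I_T -> V}) : ffun_cons a A ord0 = a.
Proof. by rewrite ffunE unlift_none. Qed.

Lemma ffun_consS T a (A : {ffun 'I_T -> V}) t :
  ffun_cons a A (lift ord0 t) = A t.
Proof. by rewrite ffunE liftK. Qed.

(** Conditioning on the first arm leaves a game one round shorter, played by the algorithm with the
    first observation put in front of its history. *)
Lemma sum_play_recl (T : nat) (alg : algorithm R V)
    (l : loss_sequence R V T.+1) (f : {ffun 'I_T.+1 -> V} -> R) :
  \sum_A play_prob E alg l A * f A =
  \sum_a alg [::] a * \sum_(A : {ffun 'I_T -> V})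
    play_prob E (fun h => alg ((a, feedback E (l ord0) a) :: h))
      (fun t => l (lift ord0 t)) A * f (ffun_cons a A).
Proof.
under [RHS]eq_bigr do rewrite mulr_sumr.
rewrite pair_big/= (reindex (fun p => ffun_cons p.1 p.2))/=; last first.
  exists (fun A => (A ord0, [ffun t => A (lift ord0 t)])) => [[a A] _|A _] /=.
    rewrite ffun_cons0; congr pair; apply/ffunP => t.
    by rewrite ffunE ffun_consS.
  apply/ffunP => t; rewrite ffunE; case: unliftP => [s ->|->] //=.
  by rewrite ffunE.
apply: eq_bigr => -[a A] _ /=; rewrite mulrA; congr (_ * _).
rewrite /play_prob big_ord_recl ffun_cons0; congr (_ * _).
  by congr (alg _ _); rewrite /history_before enum_ordSl/= filter_map/= filter_pred0.
apply: eq_bigr => t _; rewrite history_before_lift ffun_consS ffun_cons0.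
congr (alg (_ :: history_before _ _ _ _) _).
by apply/ffunP => s; rewrite ffunE ffun_consS.
Qed.

Lemma sum_play_prob (T : nat) (alg : algorithm R V) (l : loss_sequence R V T) :
  \sum_A play_prob E alg l A = 1.
Proof.
elim: T alg l => [|T IH] alg l.
  rewrite (big_pred1 (ffun0 (card_ord 0))).
    by rewrite /play_prob big_ord0.
  by move=> A; apply/esym/eqP/ffunP => -[].
under eq_bigr do rewrite -[play_prob _ _ _ _]mulr1.
rewrite sum_play_recl -[RHS](arm_prob_sum1 (alg [::])).
apply: eq_bigr => a _; under eq_bigr do rewrite mulr1.
by rewrite IH mulr1.
Qed.

(** Amortized analysis with [G] as stored credit: the one-round bounds telescope, and the final
    credit is dropped because it is nonnegative. *)
Lemma expected_sum_le (T : nat) (alg : algorithm R V) (l : loss_sequence R V T)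
    (g : 'I_T -> V -> R) (G : history R V -> R) (C : R) :
  (forall h, 0 <= G h) ->
  (forall t h, \sum_a alg h a *
     (g t a + G (rcons h (a, feedback E (l t) a))) <= G h + C) ->
  \sum_A play_prob E alg l A * \sum_(t < T) g t (A t) <= G [::] + T%:R * C.
Proof.
elim: T alg l g G => [|T IH] alg l g G G0 step.
  by rewrite big1 ?mul0r ?addr0// => A _; rewrite big_ord0 mulr0.
rewrite sum_play_recl -natr1 mulrDl mul1r addrA addrAC.
apply: le_trans (_ : \sum_a alg [::] a *
    (g ord0 a + G [:: (a, feedback E (l ord0) a)] + T%:R * C) <= _).
  apply: ler_sum => a _; apply: ler_wpM2l; first exact: arm_prob_ge0.
  under eq_bigr => A _.
    rewrite big_ord_recl ffun_cons0 mulrDr.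
    under eq_bigr do rewrite ffun_consS.
    over.
  rewrite big_split/= -mulr_suml sum_play_prob mul1r -addrA lerD2l.
  (* The credit function, like the algorithm, is restarted behind the first observation; [step]
     holds for every history, hence for these. *)
  apply: (IH _ _ (fun t => g (lift ord0 t))
    (fun h => G ((a, feedback E (l ord0) a) :: h))) =>//.
under eq_bigr do rewrite mulrDr.
rewrite big_split/= -mulr_suml arm_prob_sum1 mul1r lerD2r.
exact: (step ord0 [::]).
Qed.

End Play.

(** * The algorithm and its regret for fixed [gamma] and [eta] *)

Section Algorithm.
Context (R : realType) (V : finType) (E : rel V) (u : V -> V) (v0 : V).
Context (gamma eta : R).
Hypotheses (gamma_gt0 : 0 < gamma) (gamma_le1 : gamma <= 1) (eta_gt0 : 0 < eta).
Hypothesis uP : forall v, E (u v) v.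
Implicit Types (K : V -> R) (a v : V).

(* [u v] is the in-neighbour of [v] played in order to observe [v]. *)
Definition play_weight K a : R :=
  (1 - gamma) * root K a ^+ 2 + gamma * \sum_(v | u v == a) root K v ^+ 2.

Lemma play_weight_ge0 K a : 0 <= play_weight K a.
Proof.
rewrite addr_ge0// mulr_ge0 ?sqr_ge0 ?subr_ge0//; first exact: ltW.
by rewrite sumr_ge0// => v _; exact: sqr_ge0.
Qed.

Lemma sum_preim_root_sqr K :
  \sum_a \sum_(v | u v == a) root K v ^+ 2 = 1.
Proof. by rewrite -(sum_root_sqr v0 K) [RHS](partition_big u xpredT). Qed.

Lemma sum_play_weight K : \sum_a play_weight K a = 1.
Proof.
rewrite big_split/= -!mulr_sumr (sum_root_sqr v0).
rewrite sum_preim_root_sqr; ring.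
Qed.

Definition play_dist K : arm_dist R V :=
  ArmDist (play_weight_ge0 K) (sum_play_weight K).

Definition obs_prob K v : R := \sum_(a | E a v) play_weight K a.

Lemma obs_prob_ge K v : gamma * root K v ^+ 2 <= obs_prob K v.
Proof.
rewrite /obs_prob (bigD1 (u v))//=; apply: ler_wpDr.
  by apply: sumr_ge0 => a _; exact: play_weight_ge0.
apply: ler_wpDl; first by rewrite mulr_ge0 ?sqr_ge0 ?subr_ge0.
apply: ler_wpM2l; first exact: ltW.
rewrite (bigD1 v)//= lerDl; apply: sumr_ge0 => w _; exact: sqr_ge0.
Qed.

Lemma obs_prob_gt0 K v : 0 < obs_prob K v.
Proof.
by apply: lt_le_trans (obs_prob_ge K v); rewrite mulr_gt0 ?exprn_gt0 ?root_gt0.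
Qed.

(** Importance weighting: dividing by the observation probability makes the estimate unbiased, an
    unobserved loss counting as 0. *)
Definition loss_estimate K (fb : {ffun V -> option R}) v : R :=
  if fb v is Some z then z / obs_prob K v else 0.

Definition update K (r : V * {ffun V -> option R}) : V -> R :=
  fun v => K v + eta * loss_estimate K r.2 v.

(** A left fold, since each estimate is weighted by the observation probabilities in force when its
    round was played. *)
Definition scaled_loss (h : history R V) : V -> R := foldl update (fun=> 0) h.

Definition tsallis_alg : algorithm R V := fun h => play_dist (scaled_loss h).

Lemma loss_estimateE K (l : V -> R) a v :
  loss_estimate K (feedback E l a) v = (E a v)%:R * (l v / obs_prob K v).
Proof.
by rewrite /loss_estimate ffunE inE; case: (E a v); rewrite ?mul1r ?mul0r.
Qed.

Lemma sum_obs K v (z : R) :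
  \sum_a play_weight K a * ((E a v)%:R * z) = obs_prob K v * z.
Proof.
rewrite /obs_prob mulr_suml [RHS]big_mkcond/=; apply: eq_bigr => a _.
by case: (E a v); rewrite ?mul1r// mul0r mulr0.
Qed.

Lemma mean_loss_estimate K (l : V -> R) v :
  \sum_a play_weight K a * loss_estimate K (feedback E l a) v = l v.
Proof.
under eq_bigr do rewrite loss_estimateE.
by rewrite sum_obs mulrC divfK// gt_eqF ?obs_prob_gt0.
Qed.

(** The second moment is l_v^2 / P with P the observation probability; then l_v <= 1 and
    [obs_prob_ge] apply. *)
Lemma mean_loss_estimate_sqr K (l : V -> R) v : 0 <= l v <= 1 ->
  \sum_a play_weight K a * loss_estimate K (feedback E l a) v ^+ 2
    <= (gamma * root K v ^+ 2)^-1.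
Proof.
move=> /andP[l0 l1].
under eq_bigr => a _.
  rewrite loss_estimateE exprMn (_ : (E a v)%:R ^+ 2 = (E a v)%:R); last first.
    by case: (E a v); rewrite ?expr1n ?expr0n.
  over.
rewrite sum_obs; have P0 := obs_prob_gt0 K v.
apply: (@le_trans _ _ (obs_prob K v)^-1).
  rewrite (_ : _ * _ = l v ^+ 2 * (obs_prob K v)^-1); last first.
    by field; rewrite gt_eqF.
  by rewrite ler_piMl ?invr_ge0 ?(ltW P0)// exprn_ile1.
rewrite lef_pV2 ?posrE ?obs_prob_ge//.
by rewrite mulr_gt0 ?exprn_gt0 ?root_gt0.
Qed.

(** The credit used against the comparator [b], in unscaled loss units. *)
Definition gap b K : R := (K b - potential K) / eta.

Lemma gap_ge0 b K : 0 <= gap b K.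
Proof. by rewrite divr_ge0 ?subr_ge0 ?potential_le// ltW. Qed.

Lemma gap_update b K (l : V -> R) a e : (forall v, 0 <= l v) ->
  e = loss_estimate K (feedback E l a) ->
  gap b (update K (a, feedback E l a)) <=
  gap b K + e b - \sum_v root K v ^+ 2 * e v
    + eta * \sum_v root K v ^+ 3 * e v ^+ 2.
Proof.
move=> l0 eE; rewrite ler_pdivrMr//.
have e0 v : 0 <= eta * e v.
  rewrite mulr_ge0 ?(ltW eta_gt0)// eE loss_estimateE mulr_ge0//.
  by rewrite divr_ge0// ltW// obs_prob_gt0.
have := potential_addr v0 K e0.
rewrite (_ : (fun v => _) = update K (a, feedback E l a)); last by rewrite eE.
have -> : \sum_v root K v ^+ 2 * (eta * e v) = eta * \sum_v root K v ^+ 2 * e v.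
  by rewrite mulr_sumr; apply: eq_bigr => v _; ring.
have -> : \sum_v root K v ^+ 3 * (eta * e v) ^+ 2
    = eta ^+ 2 * \sum_v root K v ^+ 3 * e v ^+ 2.
  by rewrite mulr_sumr; apply: eq_bigr => v _; ring.
set X := \sum_v _; set Y := \sum_v _; set P := potential (update _ _) => h.
have -> : (gap b K + e b - X + eta * Y) * eta =
    K b - potential K + eta * e b - (eta * X - eta ^+ 2 * Y).
  by rewrite /gap; field; rewrite gt_eqF.
rewrite /update/= -eE; lra.
Qed.

(** Exploration has probability [gamma] and costs at most 1. *)
Lemma mean_excess_loss K (l : V -> R) : (forall v, 0 <= l v <= 1) ->
  \sum_a play_weight K a * l a <= \sum_a root K a ^+ 2 * l a + gamma.
Proof.
move=> l01.
apply: (@le_trans _ _ (\sum_a (root K a ^+ 2 * l a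
    + gamma * \sum_(v | u v == a) root K v ^+ 2))).
  apply: ler_sum => a _; have /andP[la0 la1] := l01 a.
  rewrite /play_weight.
  have : 0 <= \sum_(v | u v == a) root K v ^+ 2.
    by apply: sumr_ge0 => v _; exact: sqr_ge0.
  move: (\sum_(v | _) _) => S S0; have : 0 <= root K a ^+ 2 := sqr_ge0 _.
  move: (root K a ^+ 2) => x x0; rewrite -subr_ge0.
  have -> : x * l a + gamma * S - ((1 - gamma) * x + gamma * S) * l a
    = gamma * (S * (1 - l a)) + gamma * (x * l a) by ring.
  by rewrite addr_ge0 ?mulr_ge0 ?subr_ge0// ltW.
rewrite big_split/= -mulr_sumr.
by rewrite sum_preim_root_sqr mulr1.
Qed.

(** By unbiasedness the mean of [e a b] cancels [l b], and the first-order term cancels the mean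
    loss under the Tsallis distribution. The exploration cost and the second-order term remain. *)
Lemma gap_step b K (l : V -> R) (q : R) :
  0 < q -> q ^+ 2 = #|V|%:R -> (forall v, 0 <= l v <= 1) ->
  \sum_a play_weight K a *
     (l a - l b + gap b (update K (a, feedback E l a)))
  <= gap b K + (gamma + eta * q / gamma).
Proof.
move=> q0 qE l01; pose e a := loss_estimate K (feedback E l a).
apply: (@le_trans _ _ (\sum_a play_weight K a * (l a - l b + (gap b K + e a b
    - \sum_v root K v ^+ 2 * e a v + eta * \sum_v root K v ^+ 3 * e a v ^+ 2)))).
  apply: ler_sum => a _; apply: ler_wpM2l; first exact: play_weight_ge0.
  by rewrite lerD2l (gap_update _ _ (erefl (e a)))// => v; have /andP[] := l01 v.
have -> : \sum_a play_weight K a * (l a - l b + (gap b K + e a b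
    - \sum_v root K v ^+ 2 * e a v + eta * \sum_v root K v ^+ 3 * e a v ^+ 2))
  = \sum_a play_weight K a * l a + (gap b K - l b) * \sum_a play_weight K a
    + \sum_a play_weight K a * e a b
    - \sum_v root K v ^+ 2 * \sum_a play_weight K a * e a v
    + eta * \sum_v root K v ^+ 3 * \sum_a play_weight K a * e a v ^+ 2.
  have exch n m : \sum_v root K v ^+ n * \sum_a play_weight K a * e a v ^+ m
      = \sum_a play_weight K a * \sum_v root K v ^+ n * e a v ^+ m.
    under eq_bigr do rewrite mulr_sumr.
    rewrite exchange_big/=; apply: eq_bigr => a _.
    by rewrite mulr_sumr; apply: eq_bigr => v _; ring.
  have := exch 2 1; under eq_bigr do under eq_bigr do rewrite expr1.
  under [in RHS]eq_bigr do under eq_bigr do rewrite expr1.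
  move=> ->; rewrite exch !mulr_sumr -sumrN -!big_split/=.
  by apply: eq_bigr => a _; ring.
rewrite sum_play_weight mulr1 mean_loss_estimate.
under [X in _ - X + _]eq_bigr do rewrite mean_loss_estimate.
have h1 := mean_excess_loss K l01.
(* The second moment cancels two of the three powers of the root, leaving a sum of roots over
   [gamma]. *)
have h2 : \sum_v root K v ^+ 3 * \sum_a play_weight K a * e a v ^+ 2 <= q / gamma.
  apply: (@le_trans _ _ (\sum_v root K v / gamma)); last first.
    by rewrite -mulr_suml ler_pM2r ?invr_gt0// (sum_root_le v0).
  apply: ler_sum => v _; have r0 := root_gt0 K v.
  apply: (@le_trans _ _ (root K v ^+ 3 * (gamma * root K v ^+ 2)^-1)).
    by rewrite ler_pM2l ?exprn_gt0//; exact: mean_loss_estimate_sqr.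
  by rewrite le_eqVlt; apply/orP; left; apply/eqP; field; rewrite !gt_eqF.
have := ler_wpM2l (ltW eta_gt0) h2; rewrite mulrA; lra.
Qed.

Lemma regret_tsallis_alg (T : nat) (l : loss_sequence R V T) (q : R) :
  0 < q -> q ^+ 2 = #|V|%:R -> unit_losses l ->
  regret E tsallis_alg l
    <= 2 * q / eta + T%:R * (gamma + eta * q / gamma).
Proof.
move=> q0 qE l01; apply: ge_sup; first by exists (regret_arm E tsallis_alg l v0), v0.
move=> _ [b _ <-]; rewrite /regret_arm /expected_loss.
(* The comparator's loss is multiplied by the total probability 1 to bring it under the
   expectation. *)
rewrite -[X in _ - X]mul1r -[X in _ - X * _](sum_play_prob E tsallis_alg l).
rewrite mulr_suml -sumrB.
under eq_bigr do rewrite -mulrBr -sumrB.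
apply: le_trans (_ : gap b (scaled_loss [::]) + T%:R * (gamma + eta * q / gamma) <= _).
  apply: (expected_sum_le (g := fun t a => l t a - l t b)
    (G := fun h => gap b (scaled_loss h))) => [h|t h]; first exact: gap_ge0.
  under eq_bigr do rewrite /scaled_loss foldl_rcons.
  exact: gap_step.
rewrite lerD2r /gap /scaled_loss/= ler_pM2r ?invr_gt0//.
have := potential0_ge v0 q0 qE; lra.
Qed.

End Algorithm.

(** * Choice of the parameters *)

Theorem theorem4 (R : realType) (d : nat) (hd : (1 <= d)%N) :
  exists c : R,
    forall (V : finType) (E : rel V),
      weakly_observable E ->
      (forall v : V, (in_degree E v <= d)%N) ->
      exists T0 : nat, forall T : nat, (T0 <= T)%N ->
        exists alg : algorithm R V,
          forall l : loss_sequence R V T, unit_losses l ->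
            regret E alg l <= c * #|V|%:R `^ (1 / 3) * T%:R `^ (2 / 3).
Proof.
exists 4 => V E /andP[/existsPn obs /forallPn[v0 _]] _.
(* The default [v] is never reached: every vertex has an in-neighbour. *)
have uP v : E (odflt v [pick w | E w v]) v.
  case: pickP => //= noin; have /negP[] := obs v.
  by apply/eqP/setP => w; rewrite !inE noin.
(* T >= N makes gamma = (N/T)^(1/3) at most 1. *)
exists #|V| => T NT.
have N0 : (0 < #|V|)%N by apply/card_gt0P; exists v0.
(* In these units gamma = n^2/t, eta = n/t^2 and sqrt N = n^3, so the final bound is a rational
   identity with value 4 n^2 t^2. *)
pose n : R := #|V|%:R `^ (1 / 6); pose t : R := T%:R `^ (1 / 3).
have n0 : 0 < n by rewrite powR_gt0 ?ltr0n.
have t0 : 0 < t by rewrite powR_gt0 ?ltr0n// (leq_trans N0).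
have nX k : n ^+ k = #|V|%:R `^ (k%:R / 6).
  by rewrite -powR_mulrn ?(ltW n0)// -powRrM; congr (_ `^ _); field.
have tX k : t ^+ k = T%:R `^ (k%:R / 3).
  by rewrite -powR_mulrn ?(ltW t0)// -powRrM; congr (_ `^ _); field.
have n2 : #|V|%:R `^ (1 / 3) = n ^+ 2 by rewrite nX; congr (_ `^ _); field.
have n6 : (n ^+ 3) ^+ 2 = #|V|%:R.
  by rewrite -exprM nX (_ : _ / 6 = 1) ?powRr1//; field.
have t3 : T%:R = t ^+ 3 by rewrite tX (_ : _ / 3 = 1) ?powRr1//; field.
have n2t : n ^+ 2 / t <= 1.
  by rewrite ler_pdivrMr// mul1r -n2 ge0_ler_powR ?nnegrE ?ler0n ?ler_nat ?divr_ge0.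
have g0 : 0 < n ^+ 2 / t by rewrite divr_gt0 ?exprn_gt0.
have e0 : 0 < n / t ^+ 2 by rewrite divr_gt0 ?exprn_gt0.
exists (tsallis_alg E (fun v => odflt v [pick w | E w v]) v0 (n / t ^+ 2) g0 n2t) => l l01.
apply: le_trans (regret_tsallis_alg v0 g0 n2t e0 uP (exprn_gt0 3 n0) n6 l01) _.
rewrite n2 -tX t3 le_eqVlt; apply/orP; left; apply/eqP.
by field; rewrite !gt_eqF.
Qed.
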